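(* (i) If a Banach Lie algebra $\mathcal{L}\in\mathbf{Sem}(P_{\mathfrak{S}^{\max}})$ is solvable then $\mathcal{L}_{[2]}=\{0\}$. (ii) Let $\mathcal{L}\in\mathbf{Sem}(P_{\mathfrak{S}^{\max}})$. Then $\mathcal{L}$ is nilpotent if and only if $\mathcal{L}$ is commutative. (iii) Any solvable Banach Lie algebra in $\mathbf{Sem}(P_{\mathfrak{J}^{\max}})$ is commutative.
   Context: A Banach Lie algebra is a complex Lie algebra $\mathcal{L}$ which is a Banach space in some norm such that, for some constant $t_{\mathcal{L}}>0$, $\|[a,b]\|\leq t_{\mathcal{L}}\|a\|\|b\|$ for all $a,b\in\mathcal{L}$. $P_{\mathfrak{S}^{\max}}(\mathcal{L})$ (respectively $P_{\mathfrak{J}^{\max}}(\mathcal{L})$) is the intersection of all maximal proper closed Lie subalgebras (respectively, maximal proper closed Lie ideals) of finite codimension in $\mathcal{L}$, and is $\mathcal{L}$ if there are none. For $R$ one of these, $\mathbf{Sem}(R)$ is the class of Banach Lie algebras $\mathcal{L}$ with $R(\mathcal{L})=\{0\}$. Put $\mathcal{L}_{[0]}=\mathcal{L}$, $\mathcal{L}_{[n+1]}=\overline{[\mathcal{L}_{[n]},\mathcal{L}_{[n]}]}$ (closed linear span of commutators), and $\mathcal{L}^{[1]}=\mathcal{L}$, $\mathcal{L}^{[n+1]}=\overline{[\mathcal{L},\mathcal{L}^{[n]}]}$. $\mathcal{L}$ is solvable if $\mathcal{L}_{[n]}=\{0\}$ for some $n$, and nilpotent if $\mathcal{L}^{[n]}=\{0\}$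 for some $n$. *)

(* Defs.v *)
From HB Require Import structures.
From mathcomp Require Import all_boot all_order all_algebra.
From mathcomp Require Import complex.
From mathcomp Require Import all_classical all_reals all_analysis.

Set Implicit Arguments.
Unset Strict Implicit.
Unset Printing Implicit Defensive.

Import Order.TTheory GRing.Theory Num.Theory.
Import numFieldNormedType.Exports.

Local Open Scope classical_set_scope.
Local Open Scope ring_scope.
Local Open Scope complex_scope.

(* The scalars R[i] are the complex numbers over the reals R; the norm of a
   normed R[i]-module takes its values in the nonnegative reals inside R[i]. *)
HB.mixin Record isBanachLie (R : realType) L
    of CompleteNormedModule R[i] L := {
  lie : L -> L -> L;
  lie_linearl : forall b (k : R[i]) a a',
    lie (k *: a + a') b = k *: lie a b + lie a' b;
  lie_linearr : forall a (k : R[i]) b b',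
    lie a (k *: b + b') = k *: lie a b + lie a b';
  lie_alternating : forall a, lie a a = 0;
  lie_jacobi : forall a b c,
    lie a (lie b c) + lie b (lie c a) + lie c (lie a b) = 0;
  lie_bounded : exists2 t : R, 0 < t &
    forall a b, `|lie a b| <= t%:C * `|a| * `|b| }.

#[short(type="banachLieType")]
HB.structure Definition BanachLie (R : realType) :=
  {L of isBanachLie R L & CompleteNormedModule R[i] L}.

Section BanachLieTheory.
Context {R : realType} {L : banachLieType R}.
Implicit Types A B M : set L.

Definition linear_subspace A := submod_closed (mem A).

Definition lspan A : set L := smallest linear_subspace A.

(* [A, B] is the closed linear span of the commutators. *)
Definition lie_closure A B : set L :=
  closure (lspan [set x | exists a b, [/\ A a, B b & x = lie a b]]).

Definition lie_subalgebra A :=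
  linear_subspace A /\ (forall a b, A a -> A b -> A (lie a b)).

Definition lie_ideal A :=
  linear_subspace A /\ (forall a b, A b -> A (lie a b)).

(* The quotient L / A is spanned by finitely many classes. *)
Definition finite_codim A :=
  exists n (e : 'I_n -> L),
    forall x, exists c : 'I_n -> R[i], A (x - \sum_i c i *: e i).

Definition proper_closed (P : set L -> Prop) A :=
  [/\ P A, closed A & A <> setT].

Definition maximal_proper_closed (P : set L -> Prop) M :=
  proper_closed P M /\
  (forall A, proper_closed P A -> M `<=` A -> A = M).
End BanachLieTheory.

Section BanachLieRadicals.
Context {R : realType} (L : banachLieType R).

(* An intersection over an empty family is setT. *)
Definition P_Smax : set L :=
  \bigcap_(M in [set M | maximal_proper_closed lie_subalgebra M /\
                         finite_codim M]) M.

Definition P_Jmax : set L :=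
  \bigcap_(M in [set M | maximal_proper_closed lie_ideal M /\
                         finite_codim M]) M.

Fixpoint lie_derived_series (n : nat) : set L :=
  if n is m.+1 then lie_closure (lie_derived_series m) (lie_derived_series m)
  else setT.

(* The lower central series L^[1] = L, L^[2], ... is numbered from 1:
   lie_lower_series n is L^[n+1]. *)
Fixpoint lie_lower_series (n : nat) : set L :=
  if n is m.+1 then lie_closure setT (lie_lower_series m) else setT.

Definition lie_solvable := exists n, lie_derived_series n = [set 0].

Definition lie_nilpotent := exists n, lie_lower_series n = [set 0].

Definition lie_commutative := forall a b : L, lie a b = 0.
End BanachLieRadicals.

Arguments P_Smax {R} L _.
Arguments P_Jmax {R} L _.
Arguments lie_derived_series {R} L n _.
Arguments lie_lower_series {R} L n _.

Definition Sem {R : realType} (P : forall L : banachLieType R, set L)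
  (L : banachLieType R) := P L = [set 0].

(* Main.v *)
From HB Require Import structures.
Require Import Defs.
From mathcomp Require Import all_boot all_order all_algebra.
From mathcomp Require Import complex.
From mathcomp Require Import all_classical all_reals all_analysis.

(** Everything comes from locating a maximal closed subalgebra, or ideal, [M] of
finite codimension with respect to a descending series of closed ideals that
begins with [L] and ends with [0]. Let [A] be the last term that is not
contained in [M]. Then [A + M] is again a subalgebra (an ideal if [M] is one).
It contains the closed subspace [M] of finite codimension, so it is closed
([closed_finite_codim_sub]), and maximality gives [L = A + M]
([maximal_subalgebra_add], [maximal_ideal_add]).

For a maximal ideal [M] and the derived series, [[A, A]] lies in [M], hence
[[L, L] = [A + M, A + M]] lies in [M]. For a maximal subalgebra [M] and the lower
central series, [[L, A]] lies in [M], hence so does [[L, L]]. Intersecting over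
all [M] gives commutativity in both cases.

For a maximal subalgebra [M] and the derived series, [A `&` M] is an ideal of
[L], and [L] acts on the nonzero finite-dimensional space [A / (A `&` M)], which
is also [L / M]. This representation is irreducible: the preimage in [L] of an
invariant subspace is a subalgebra containing [M], closed as before, so it is
[M] or [L]. As in Lie's theorem, the terms [L_[k]] of the derived series with
[k >= 1] act trivially, by descending induction on [k], starting from [A] itself:
[[A, A] `<=` M]. If [L_[k+1]] acts trivially, then [L_[k]] acts by an ideal of
commuting operators, which are scalars by irreducibility
([irreducible_commuting_scalar]); a commutator of elements of [L_[k-1]] is then a
scalar of trace zero, that is, zero. For [k = 1] the result reads
[[A, L_[1]] `<=` M], and together with [L = A + M] it gives [L_[2] `<=` M]
([solvable_maximal_subalgebra]). *)

Set Implicit Arguments. Unset Strict Implicit. Unset Printing Implicit Defensive.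
Import Order.TTheory GRing.Theory Num.Theory.
Import numFieldNormedType.Exports.
Local Open Scope classical_set_scope.
Local Open Scope ring_scope.
Local Open Scope complex_scope.

(** * Commuting ideals of operators in an irreducible representation *)

(** The family may be infinite. If some member is not scalar, the argument passes
to one of its eigenspaces, which is proper and stable under the family. *)
Lemma commuting_family_eigenvector (F : numClosedFieldType) n
    (S : 'M[F]_n -> Prop) :
  (n > 0)%N -> (forall A B, S A -> S B -> A *m B = B *m A) ->
  exists2 v : 'rV_n, v != 0 & forall A, S A -> exists a, v *m A = a *: v.
Proof.
have [k le_nk] := ubnP n; elim: k n le_nk S => // k IHk n; rewrite ltnS => le_nk.
move=> S n_gt0 S_comm.
have [S_scalar|] := pselect (forall A, S A -> is_scalar_mx A).
  exists (const_mx 1) => [|A /S_scalar/is_scalar_mxP[a ->]]; last first.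
    by exists a; rewrite mul_mx_scalar.
  apply/negP => /eqP/rowP/(_ (Ordinal n_gt0)).
  by rewrite !mxE => /eqP; rewrite oner_eq0.
move=> /existsNP[A /not_implyP[SA A_nscalar]].
have [a a_eig] := eigenvalue_closed A n_gt0.
set E := eigenspace A a.
have E_stable B : S B -> stablemx E B.
  by move=> SB; apply: comm_mx_stable_eigenspace; exact: S_comm.
have ltE : (\rank E < n)%N.
  rewrite ltn_neqAle rank_leq_row andbT; apply/negP => /eqP E_full.
  apply: A_nscalar; apply/is_scalar_mxP; exists a.
  have: (1%:M <= E)%MS by rewrite sub1mx /row_full E_full.
  by move/eigenspaceP; rewrite mul1mx scalemx1.
have [||_ _ [B SB <-] [C SC <-]|v vN0 v_eig] := IHk (\rank E) _
  (fun B' => exists2 B, S B & restrictmx E B = B').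
- exact: leq_trans ltE le_nk.
- by rewrite lt0n mxrank_eq0.
- by rewrite -!conjmxM ?inE ?stablemx_row_base ?E_stable// S_comm.
exists (v *m row_base E); first by rewrite mulmx_free_eq0 ?row_base_free.
move=> B SB; apply/sub_rVP.
have [|c /(ex_intro _ c)/sub_rVP] := v_eig (restrictmx E B); first by exists B.
by rewrite (stablemx_restrict _ (E_stable B SB)).
Qed.

(** If [x] commutes with the commutator of [x] and [y], then that commutator has
eigenvalue [0] on every common eigenvector [v]. Put [X = x - a]. If the
eigenvalue is [b], then [v y^k X^k = k! b^k v] for all [k], which for [b != 0]
contradicts the Cayley-Hamilton theorem applied to [x]. *)
Lemma commutator_eigenvalue0 (F : numFieldType) n (x y : 'M[F]_n)
    (v : 'rV_n) a b :
  v != 0 -> v *m x = a *: v -> v *m (y *m x - x *m y) = b *: v ->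
  x *m (y *m x - x *m y) = (y *m x - x *m y) *m x -> b = 0.
Proof.
case: n x y v => [|n] x y v vN0.
  by case/negP: vN0; apply/eqP/rowP; case.
set z := _ - _ => vx vz xz.
have {xz} xz : x * z = z * x by [].
have zE : z = y * x - x * y by []; clearbody z.
pose X := x - a%:M.
have vX : v *m X = 0 by rewrite mulmxBr mul_mx_scalar vx subrr.
have aC (u : 'M[F]_n.+1) : a%:M * u = u * a%:M.
  by rewrite -[LHS]/(_ *m _) -[RHS]/(_ *m _) scalar_mxC.
have Xz : z * X = X * z by rewrite mulrBl mulrBr -xz aC.
have yX : y * X = X * y + z.
  by rewrite mulrBl mulrBr zE aC addrAC [x * y + _]addrC subrK.
have yXn k : y * X ^+ k = X ^+ k * y + z * X ^+ k.-1 *+ k.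
  elim: k => [|k IHk]; first by rewrite !expr0 mulr1 mul1r mulr0n addr0.
  rewrite exprSr mulrA IHk mulrDl -mulrA yX mulrDr -!mulrA -addrA; congr (_ + _).
  rewrite mulrSr addrC; congr (_ + _); last first.
    exact/commr_sym/commrX.
  case: k {IHk} => [|k]; first by rewrite !mulr0n mul0r.
  by rewrite /= mulrnAl -mulrA -exprSr.
have vyX k : v *m (y ^+ k * X ^+ k) = (b ^+ k *+ k`!) *: v.
  elim: k => [|k IHk]; first by rewrite !expr0 mulr1 mulmx1 scale1r.
  have vyX0 : v *m (y ^+ k * X ^+ k.+1) = 0.
    rewrite exprSr mulrA [v *m _]mulmxA IHk -scalemxAl vX scaler0 //.
  have -> : y ^+ k.+1 * X ^+ k.+1
    = y ^+ k * X ^+ k.+1 * y + y ^+ k * X ^+ k * z *+ k.+1.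
    rewrite exprSr -mulrA yXn mulrDr mulrA; congr (_ + _).
    rewrite mulrnAr -mulrA; congr (_ * _ *+ _) => /=.
    exact/commrX.
  rewrite mulmxDr [v *m (_ * y)]mulmxA vyX0 mul0mx add0r.
  rewrite -scaler_nat -scalemxAr [v *m (_ * z)]mulmxA IHk -scalemxAl vz !scalerA.
  congr (_ *: _).
  by rewrite factS exprSr mulr_natl mulrnAl -mulrnA mulnC.
(* char_poly x = q * ('X - a)^k with q.[a] != 0; evaluating it at x and applying
   it to v y^k gives k! b^k q(a) v = 0. *)
have [k [q pN0 pE]] := multiplicity_XsubC (char_poly x) a.
have {pN0} qN0 : ~~ root q a.
  by apply: (implyP pN0); rewrite monic_neq0 // char_poly_monic.
have vq (p : {poly F}) : v *m horner_mx x p = p.[a] *: v.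
  elim/poly_ind: p => [|p c IHp].
    by rewrite rmorph0 mulmx0 horner0 scale0r.
  rewrite rmorphD rmorphM /= horner_mx_X horner_mx_C mulmxDr [v *m (_ * x)]mulmxA.
  by rewrite IHp -scalemxAl vx mul_mx_scalar scalerA -scalerDl hornerMXaddC.
have Xpoly : horner_mx x ('X - a%:P) = X.
  by rewrite rmorphB /= horner_mx_X horner_mx_C.
have := Cayley_Hamilton x; rewrite pE mulrC rmorphM rmorphXn /= Xpoly => pX0.
have : v *m (y ^+ k * (X ^+ k * horner_mx x q)) = 0 by rewrite pX0 mulr0 mulmx0.
rewrite mulrA [v *m (_ * horner_mx _ _)]mulmxA vyX -scalemxAl vq scalerA => /eqP.
rewrite scaler_eq0 (negbTE vN0) orbF mulf_eq0 -[_.[a] == 0]/(root q a).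
rewrite (negbTE qN0) orbF mulrn_eq0 gtn_eqF ?fact_gt0 //= expf_eq0.
by case/andP=> _ /eqP.
Qed.

(** [G] is an irreducible set of operators on row vectors, and [J] is a commuting
set stable under commutators with [G]. The weight space of a common eigenvector of
[J] is [G]-stable because the weight vanishes on those commutators, so it is the
whole space. *)
Lemma irreducible_commuting_scalar (F : numClosedFieldType) n
    (G J : 'M[F]_n -> Prop) :
  (n > 0)%N ->
  (forall W : 'rV[F]_n -> Prop, (forall k u v, W u -> W v -> W (k *: u + v)) ->
    (forall B v, G B -> W v -> W (v *m B)) ->
    (exists2 v, v != 0 & W v) -> forall v, W v) ->
  (forall A B, J A -> J B -> A *m B = B *m A) ->
  (forall A B, J A -> G B -> J (B *m A - A *m B)) ->
  forall A, J A -> exists a, A = a%:M.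
Proof.
move=> n_gt0 G_irr J_comm J_ideal.
have [v vN0 v_eig] := commuting_family_eigenvector n_gt0 J_comm.
pose W (u : 'rV[F]_n) := forall A a, J A -> v *m A = a *: v -> u *m A = a *: u.
have W_all : forall u, W u.
  apply: G_irr; last by exists v.
    move=> k u w Wu Ww A a JA vA.
    by rewrite mulmxDl -scalemxAl (Wu A a) // (Ww A a) // scalerDr !scalerA mulrC.
  move=> B u GB Wu A a JA vA; have JBA := J_ideal A B JA GB.
  have [b vb] := v_eig _ JBA.
  have b0 : b = 0 by apply: (commutator_eigenvalue0 vN0 vA vb); exact: J_comm.
  have := Wu _ b JBA vb; rewrite b0 scale0r mulmxBr => /subr0_eq.
  by rewrite !mulmxA => ->; rewrite (Wu A a) // -scalemxAl.
move=> A JA; have [a vA] := v_eig A JA; exists a.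
by apply/row_matrixP => i; rewrite !rowE mul_mx_scalar; apply: W_all.
Qed.

Lemma linear_mx (F : fieldType) n (f : 'rV[F]_n -> 'rV[F]_n) :
  (forall k u v, f (k *: u + v) = k *: f u + f v) ->
  exists B, forall v, v *m B = f v.
Proof.
move=> f_lin; pose fL : {linear 'rV[F]_n -> 'rV[F]_n} :=
  HB.pack f (GRing.isLinear.Build _ _ _ _ f f_lin).
by exists (lin1_mx fL) => v; rewrite mul_rV_lin1.
Qed.

(** * Closed subspaces of finite codimension *)

Section ClosedSubspaces.
Context {R : realType} {L : normedModType R[i]}.
Implicit Types M N : set L.

Lemma gt0_complexP (e : R[i]) : 0 < e -> exists2 r : R, 0 < r & e = r%:C.
Proof.
move=> e0; have /complex_realP[r er] : e \is Num.real by exact: gtr0_real.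
by exists r => //; move: e0; rewrite er ltcR.
Qed.

Lemma normc_i : `|'i%C : R[i]| = 1.
Proof. by rewrite normc_def /= expr0n add0r expr1n sqrtr1. Qed.

Lemma normc_ge_Im (x : R[i]) : `|complex.Im x|%:C <= `|x|.
Proof.
by have := normc_ge_Re (x * 'i); rewrite ReiNIm normrN normrM normc_i mulr1.
Qed.

(** Completeness of the complex numbers, for a function along a filter; the real
and imaginary parts converge separately. *)
Lemma complex_cauchy_cvg (T : Type) (F : set_system T) {FF : ProperFilter F}
    (g : T -> R[i]) :
  (forall e : R, 0 < e -> \forall x & y \near F, `|g x - g y| < e%:C) ->
  exists c : R[i]^o, (g : T -> R[i]^o) @ F --> c.
Proof.
move=> g_cauchy.
have part_cvg (h : R[i] -> R) : (forall x y, h (x - y) = h x - h y) ->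
    (forall x, (`|h x|%:C <= `|x|)) -> cvg (h \o g @ F).
  move=> hB h_le; apply: cauchy_cvg; apply/cauchy_ballP => e e0.
  rewrite near_map2; apply: filterS (g_cauchy e e0) => -[x y] /= gxy.
  by rewrite -ball_normE /ball_ /= -hB -ltcR; exact: le_lt_trans (h_le _) gxy.
have /cvg_ex[a ga] := part_cvg (@complex.Re R) (raddfB _) (@normc_ge_Re R).
have /cvg_ex[b gb] := part_cvg (@complex.Im R) (raddfB _) normc_ge_Im.
exists (a +i* b)%C; apply/cvgrPdist_lt => _ /gt0_complexP[e e0 ->].
have e20 : 0 < e / 2 by rewrite divr_gt0.
move/cvgrPdist_lt : ga => /(_ _ e20) ga; move/cvgrPdist_lt : gb => /(_ _ e20) gb.
near=> t.
rewrite [X in `|X|]complexE; apply: le_lt_trans (ler_normD _ _) _.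
rewrite normrM normc_i mul1r ![`|_%:C|]normc_def /= !expr0n !addr0 !sqrtr_sqr.
rewrite -rmorphD /= ltcR.
rewrite [e]splitr ltrD //; near: t; [move: ga|move: gb]; apply: filterS => t /=;
  by case: (g t).
Unshelve. all: by end_near. Qed.

(** Adding a line to a closed subspace [M] gives a closed subspace. When [v] lies
at distance [d > 0] from [M], the coefficient of [v] is Lipschitz with
constant [1 / d] on [M + C v], so it converges along any filter on [M + C v] that
converges to a point of the closure. *)
Lemma closed_add_line M (v : L) : closed M -> submod_closed (mem M) ->
  closed [set x | exists c : R[i], M (x - c *: v)].
Proof.
move=> M_closed [M0 M_lin]; set N := [set x | _].
have {}M_lin a u w : M u -> M w -> M (a *: u + w).
  by move=> Mu Mw; move: (M_lin a u w); rewrite !inE; apply.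
have [Mv|nMv] := pselect (M v).
  suff -> : N = M by [].
  apply/seteqP; split=> [x [c Mx]|x Mx]; last by exists 0; rewrite scale0r subr0.
  by rewrite -[x](subrK (c *: v)) addrC; apply: M_lin.
have [d d0 Md] : exists2 d : R, 0 < d & forall m, M m -> d%:C <= `|v - m|.
  have /nbhs_normP[_ /gt0_complexP[d d0 ->] dM] : nbhs v (~` M).
    by apply: open_nbhs_nbhs; split=> //; exact: closed_openC.
  exists d => // m Mm; rewrite real_leNgt ?normr_real //.
    by apply/negP => /dM /(_ Mm).
  by rewrite ger0_real // ler0c ltW.
have norm_ge c (w : L) : M w -> `|c| * d%:C <= `|c *: v + w|.
  move=> Mw; have [->|c0] := eqVneq c 0; first by rewrite normr0 mul0r.
  have -> : c *: v + w = c *: (v - (- c^-1) *: w).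
    by rewrite scaleNr opprK scalerDr scalerA divff // scale1r.
  rewrite normrZ ler_wpM2l //; apply: Md; rewrite -[_ *: w]addr0.
  by apply: M_lin => //; move: M0; rewrite inE.
pose phi x := xget (0 : R[i]) [set c | M (x - c *: v)].
have phiP x : N x -> M (x - phi x *: v).
  exact: (@xgetPex _ 0 [set c | M (x - c *: v)]).
have phi_lip x y : N x -> N y -> `|phi x - phi y| * d%:C <= `|x - y|.
  move=> /phiP Mx /phiP My.
  have := norm_ge (phi x - phi y) _ (M_lin (-1) _ _ My Mx).
  suff -> : (phi x - phi y) *: v +
      (-1 *: (y - phi y *: v) + (x - phi x *: v)) = x - y.
    by [].
  by rewrite scaleN1r opprB scalerBl !addrA subrK addrC !addrA addNr add0r addrC.
move=> x xN; pose F := within N (nbhs x).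
have FF : ProperFilter F by exact: within_nbhs_proper.
have [|c phi_c] := @complex_cauchy_cvg _ F _ phi.
  move=> e e0; have ed0 : 0 < (e * d / 2)%:C :> R[i].
    by rewrite ltcR divr_gt0 ?mulr_gt0.
  have near_x : \forall y \near F, N y /\ `|x - y| < (e * d / 2)%:C.
    have : \forall y \near x, `|x - y| < (e * d / 2)%:C.
      by apply/nbhs_normP; exists (e * d / 2)%:C.
    by apply: filterS.
  exists ([set y | N y /\ `|x - y| < (e * d / 2)%:C],
    [set y | N y /\ `|x - y| < (e * d / 2)%:C]) => //.
  move=> [y z] /= [[Ny xy] [Nz xz]].
  have d0' : 0 < d%:C :> R[i] by rewrite ltcR.
  rewrite -(ltr_pM2r d0'); apply: le_lt_trans (phi_lip _ _ Ny Nz) _.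
  have -> : e%:C * d%:C = (e * d / 2)%:C + (e * d / 2)%:C :> R[i].
    by rewrite -rmorphD -splitr rmorphM.
  rewrite -[y - z](subrKA x).
  by apply: le_lt_trans (ler_normD _ _) _; rewrite ltrD // distrC.
exists c; apply: (@closed_cvg _ _ F _ (fun y => y - phi y *: v) M M_closed).
  by apply: filterS (withinT _ _) => y; exact: phiP.
apply: cvgB; first exact: cvg_within.
exact: cvgZr_tmp.
Qed.

End ClosedSubspaces.

(** * Brackets, closed spans of commutators and the two series *)

Section LieClosure.
Context {R : realType} {L : banachLieType R}.
Implicit Types (A B M N : set L) (a b x y : L).

Lemma linear_subspaceP A : linear_subspace A <->
  A 0 /\ (forall (k : R[i]) u v, A u -> A v -> A (k *: u + v)).
Proof.
by split=> -[A0 Alin]; split; move: A0; rewrite ?inE // => A0 k u v;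
  move: (Alin k u v); rewrite ?inE.
Qed.

Lemma linear_subspace0 A : linear_subspace A -> A 0.
Proof. by case/linear_subspaceP. Qed.

Lemma linear_subspaceZ A (k : R[i]) x : linear_subspace A -> A x -> A (k *: x).
Proof.
by case/linear_subspaceP=> A0 Alin Ax; rewrite -[_ *: _]addr0; apply: Alin.
Qed.

Lemma linear_subspaceD A x y : linear_subspace A -> A x -> A y -> A (x + y).
Proof.
by case/linear_subspaceP=> A0 Alin Ax Ay; rewrite -[x]scale1r; apply: Alin.
Qed.

Lemma linear_subspaceN A x : linear_subspace A -> A x -> A (- x).
Proof. by move=> Alin Ax; rewrite -scaleN1r; apply: linear_subspaceZ. Qed.

Lemma linear_subspaceB A x y : linear_subspace A -> A x -> A y -> A (x - y).
Proof.
by move=> Alin Ax Ay; apply: linear_subspaceD => //; apply: linear_subspaceN.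
Qed.

Lemma linear_subspace_sum A n (f : 'I_n -> L) : linear_subspace A ->
  (forall i, A (f i)) -> A (\sum_i f i).
Proof.
move=> Alin Af; elim/big_ind: _ => //; first exact: linear_subspace0.
by move=> x y; apply: linear_subspaceD.
Qed.

Lemma linear_subspaceT : linear_subspace (setT : set L).
Proof. by apply/linear_subspaceP. Qed.

Lemma lieDl a a' b : lie (a + a') b = lie a b + lie a' b.
Proof. by rewrite -[a]scale1r lie_linearl !scale1r. Qed.

Lemma lieDr a b b' : lie a (b + b') = lie a b + lie a b'.
Proof. by rewrite -[b]scale1r lie_linearr !scale1r. Qed.

Lemma lie0l b : lie 0 b = 0.
Proof. by apply: (addrI (lie 0 b)); rewrite -lieDl !addr0. Qed.

Lemma lie0r b : lie b 0 = 0.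
Proof. by apply: (addrI (lie b 0)); rewrite -lieDr !addr0. Qed.

Lemma lieZl (k : R[i]) a b : lie (k *: a) b = k *: lie a b.
Proof. by rewrite -[k *: a]addr0 lie_linearl lie0l addr0. Qed.

Lemma lieZr (k : R[i]) a b : lie a (k *: b) = k *: lie a b.
Proof. by rewrite -[k *: b]addr0 lie_linearr lie0r addr0. Qed.

Lemma lieNl a b : lie (- a) b = - lie a b.
Proof. by rewrite -scaleN1r lieZl scaleN1r. Qed.

Lemma lieBl a a' b : lie (a - a') b = lie a b - lie a' b.
Proof. by rewrite lieDl lieNl. Qed.

Lemma lieC a b : lie a b = - lie b a.
Proof.
apply/eqP; rewrite -addr_eq0; apply/eqP.
have := lie_alternating (a + b).
by rewrite lieDl !lieDr !lie_alternating add0r addr0.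
Qed.

Lemma lieBr a b b' : lie a (b - b') = lie a b - lie a b'.
Proof. by rewrite ![lie a _]lieC lieBl opprD. Qed.

Lemma lie_derivation x a b : lie x (lie a b) = lie (lie x a) b + lie a (lie x b).
Proof.
have := lie_jacobi x a b; rewrite [lie b (lie _ _)]lieC [lie b x]lieC.
rewrite -[- lie x b]scaleN1r lieZr scaleN1r => /eqP.
by rewrite -addrA -opprD subr_eq0 addrC => /eqP.
Qed.

Lemma lie_continuousl b : continuous (fun a => lie a b).
Proof.
move=> x; have [t t0 t_bound] := @lie_bounded R L.
apply/cvgrPdist_lt => e e0.
have c0 : 0 < t%:C * `|b| + 1 by rewrite ltr_wpDl // mulr_ge0 // ler0c ltW.
near=> y; rewrite -lieBl; apply: le_lt_trans (t_bound _ _) _.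
rewrite mulrAC; apply: (@le_lt_trans _ _ ((t%:C * `|b| + 1) * `|x - y|)).
  by rewrite ler_wpM2r // lerDl.
rewrite -ltr_pdivlMl // mulrC; near: y.
by apply/nbhs_normP; exists (e / (t%:C * `|b| + 1)); rewrite /= ?divr_gt0.
Unshelve. all: by end_near. Qed.

Lemma closed_continuous_preimage (f : L -> L) A :
  continuous f -> closed A -> closed (f @^-1` A).
Proof. by move=> fC; apply: preimage_closed => x _; apply: fC. Qed.

Lemma closure_sub A C : closed C -> A `<=` C -> closure A `<=` C.
Proof. by move=> /closure_id {2}-> AC; apply: closureS. Qed.

Lemma closure_linear_subspace A :
  linear_subspace A -> linear_subspace (closure A).
Proof.
move=> /linear_subspaceP[A0 Alin]; apply/linear_subspaceP; split.
  exact: subset_closure.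
move=> k u v; pose f (u v : L) := k *: u + v.
have fCl w : continuous (f^~ w).
  by move=> z; apply: cvgD; [exact: scaler_continuous|exact: cvg_cst].
have fCr w : continuous (f w).
  by move=> z; apply: cvgD; [exact: cvg_cst|exact: cvg_id].
have step w : A w -> closure A `<=` f w @^-1` closure A.
  move=> Aw; apply: closure_sub => [|z Az].
    by apply: closed_continuous_preimage (fCr w) _; exact: closed_closure.
  by apply: subset_closure; exact: Alin.
move=> Au Av; move: u Au; apply: closure_sub => [|z Az]; last exact: step.
exact: closed_continuous_preimage (fCl v) (@closed_closure _ _).
Qed.

Lemma lspan_linear_subspace A : linear_subspace (lspan A).
Proof.
apply/linear_subspaceP; split=> [X [/linear_subspaceP[]]//|k u v Au Av X XP].
by have [/linear_subspaceP[_ Xlin] _] := XP; apply: Xlin; [exact: Au|exact: Av].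
Qed.

Lemma lie_closure_linear_subspace A B : linear_subspace (lie_closure A B).
Proof. exact/closure_linear_subspace/lspan_linear_subspace. Qed.

Lemma lie_closure_closed A B : closed (lie_closure A B).
Proof. exact: closed_closure. Qed.

Lemma lie_closure_lie A B a b : A a -> B b -> lie_closure A B (lie a b).
Proof.
by move=> Aa Bb; apply: subset_closure; apply: sub_gen_smallest; exists a, b.
Qed.

Lemma lie_closure_sub A B C : linear_subspace C -> closed C ->
  (forall a b, A a -> B b -> C (lie a b)) -> lie_closure A B `<=` C.
Proof.
move=> C_lin C_closed ABC; apply: closure_sub => //; apply: smallest_sub => //.
by move=> _ [a [b [Aa Bb ->]]]; apply: ABC.
Qed.

Lemma preimage_lie_subspace A b : linear_subspace A ->
  linear_subspace [set a | A (lie a b)].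
Proof.
move=> /linear_subspaceP[A0 Alin]; apply/linear_subspaceP.
by split=> [|k u v Au Av] /=; rewrite ?lie0l // lie_linearl; apply: Alin.
Qed.

Lemma preimage_lie_closed A b : closed A -> closed [set a | A (lie a b)].
Proof. by apply: closed_continuous_preimage; exact: lie_continuousl. Qed.

Lemma lie_idealC A a b : lie_ideal A -> A a -> A (lie a b).
Proof.
by case=> Alin Aid Aa; rewrite lieC; apply: linear_subspaceN => //; apply: Aid.
Qed.

Lemma lie_closure_ideal A B : lie_ideal A -> lie_ideal B ->
  lie_ideal (lie_closure A B).
Proof.
move=> A_id B_id; have lin := @lie_closure_linear_subspace A B.
split=> // x y ABy; rewrite lieC; apply: (linear_subspaceN lin); move: y ABy.
apply: lie_closure_sub => [||a b Aa Bb].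
- exact: preimage_lie_subspace.
- by apply: preimage_lie_closed; exact: lie_closure_closed.
- rewrite /= lieC; apply: (linear_subspaceN lin); rewrite lie_derivation.
  by apply: (linear_subspaceD lin); apply: lie_closure_lie => //;
    [case: A_id|case: B_id] => _; apply.
Qed.

Lemma lie_idealT : lie_ideal (setT : set L).
Proof. by split=> //; exact: linear_subspaceT. Qed.

Lemma derived_series_ideal n : lie_ideal (lie_derived_series L n).
Proof.
by elim: n => [|n IHn] /=; [exact: lie_idealT|exact: lie_closure_ideal].
Qed.

Lemma lower_series_ideal n : lie_ideal (lie_lower_series L n).
Proof.
by elim: n => [|n IHn] /=; [|apply: lie_closure_ideal => //]; exact: lie_idealT.
Qed.

(** A subspace that contains a closed subspace of finite codimension is closed: it
is obtained from [M] by adding finitely many lines contained in [N]. *)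
Lemma closed_finite_codim_sub M N : closed M -> linear_subspace M ->
  finite_codim M -> linear_subspace N -> M `<=` N -> closed N.
Proof.
move=> M_closed M_lin [n [e M_span]] N_lin MN.
(* Only the vectors of N have to be reached, so that N is kept fixed while M
   grows and the number of spanning vectors decreases. *)
have {}M_span x : N x -> exists c : 'I_n -> R[i], M (x - \sum_i c i *: e i).
  by move=> _; exact: M_span.
elim: n e M M_closed M_lin MN M_span => [|n IHn] e M M_closed M_lin MN M_span.
  suff -> : N = M by [].
  apply/seteqP; split=> // x /M_span[c]; by rewrite big_ord0 subr0.
pose e' i := e (lift ord0 i).
(* If some w in N involves e ord0 modulo M, then w replaces e ord0 once it is
   added to M; otherwise e ord0 is not needed. *)
have [[w [c [Nw Mw c0]]]|noc] := pselect (exists w, exists c : 'I_n.+1 -> R[i],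
    [/\ N w, M (w - \sum_i c i *: e i) & c ord0 != 0]); last first.
  apply: (IHn e' M) => // x Nx; have [c Mc] := M_span x Nx.
  exists (fun i => c (lift ord0 i)).
  have [c0|c0] := eqVneq (c ord0) 0; last by case: noc; exists x, c.
  by move: Mc; rewrite big_ord_recl c0 scale0r add0r.
apply: (IHn e' [set x | exists k : R[i], M (x - k *: w)]).
- exact: closed_add_line.
- apply/linear_subspaceP; split=> [|k u v [ku Mu] [kv Mv]].
    by exists 0; rewrite scale0r subr0; exact: linear_subspace0.
  exists (k * ku + kv).
  have -> : k *: u + v - (k * ku + kv) *: w = k *: (u - ku *: w) + (v - kv *: w).
    by rewrite scalerDl scalerBr scalerA opprD addrACA.
  by apply: linear_subspaceD => //; apply: linear_subspaceZ.
- move=> x [k Mx]; rewrite -[x](subrK (k *: w)).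
  by apply: linear_subspaceD => //; [exact: MN|exact: linear_subspaceZ].
- move=> x Nx; have [d Md] := M_span x Nx; pose k := d ord0 / c ord0.
  exists (fun i => d (lift ord0 i) - k * c (lift ord0 i)), k.
  have := linear_subspaceB M_lin Md (linear_subspaceZ k M_lin Mw).
  congr M; rewrite !big_ord_recl scalerBr scalerDr scalerA divfK // scaler_sumr.
  under [in RHS]eq_bigr do rewrite scalerBl -scalerA.
  rewrite sumrB /e' opprB !addrA; congr (_ - _).
  by rewrite -!addrA; congr (x + _); rewrite addrC [X in X - _]addrC addrKA opprB.
Qed.

End LieClosure.

(** * Complements of maximal subalgebras and ideals *)

Section MaximalSubspaces.
Context {R : realType} {L : banachLieType R}.
Implicit Types (A B M N : set L) (a b x y : L).

Lemma last_not_subset (X : nat -> set L) M :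
  ~ X 0%N `<=` M -> (exists n, X n `<=` M) ->
  exists n, ~ X n `<=` M /\ X n.+1 `<=` M.
Proof.
move=> X0 [n]; elim: n => [//|n IHn] XM.
by have [/IHn|] := pselect (X n `<=` M); last by exists n.
Qed.

(** [P] is meant to be [lie_subalgebra] or [lie_ideal]. The set
[[set x | exists2 a, A a & M (x - a)]] is the sum [A + M]. *)
Lemma maximal_complement (P : set L -> Prop) M A :
  (forall B, P B -> linear_subspace B) ->
  maximal_proper_closed P M -> finite_codim M -> linear_subspace A ->
  P [set x | exists2 a, A a & M (x - a)] -> ~ A `<=` M ->
  forall x, exists2 a, A a & M (x - a).
Proof.
move=> P_lin [[PM M_closed _] M_max] M_fin A_lin.
set N := [set x | _] => PN nAM x; have M_lin := P_lin _ PM.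
have MN : M `<=` N.
  by move=> y My; exists 0; rewrite ?subr0 //; exact: linear_subspace0.
have AN : A `<=` N.
  by move=> a Aa; exists a => //; rewrite subrr; exact: linear_subspace0.
suff NT : N = setT by have : N x by rewrite NT.
apply: contrapT => nNT; apply: nAM; rewrite -(M_max N) //; split=> //.
exact: (closed_finite_codim_sub M_closed M_lin M_fin (P_lin _ PN) MN).
Qed.

Lemma add_linear_subspace A M : linear_subspace A -> linear_subspace M ->
  linear_subspace [set x | exists2 a, A a & M (x - a)].
Proof.
move=> A_lin M_lin; apply/linear_subspaceP; split.
  by exists 0; rewrite ?subr0; exact: linear_subspace0.
move=> k u v [a Aa Ma] [b Ab Mb]; exists (k *: a + b).
  by apply: linear_subspaceD => //; exact: linear_subspaceZ.
rewrite opprD addrACA -scalerBr.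
by apply: linear_subspaceD => //; exact: linear_subspaceZ.
Qed.

Lemma add_ideal_subalgebra A M : lie_ideal A -> lie_subalgebra M ->
  lie_subalgebra [set x | exists2 a, A a & M (x - a)].
Proof.
move=> A_id [M_lin M_lie]; have [A_lin A_lie] := A_id.
split=> [|x y [a Aa Ma] [b Ab Mb]]; first exact: add_linear_subspace.
exists (lie a y + lie (x - a) b).
  by apply: linear_subspaceD => //; [exact: lie_idealC|exact: A_lie].
by rewrite opprD addrA -lieBl -lieBr; apply: M_lie.
Qed.

Lemma add_ideal_ideal A M : lie_ideal A -> lie_ideal M ->
  lie_ideal [set x | exists2 a, A a & M (x - a)].
Proof.
move=> [A_lin A_lie] [M_lin M_lie].
split=> [|x y [b Ab Mb]]; first exact: add_linear_subspace.
by exists (lie x b); [exact: A_lie|rewrite -lieBr; exact: M_lie].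
Qed.

Lemma maximal_subalgebra_add A M :
  maximal_proper_closed lie_subalgebra M -> finite_codim M ->
  lie_ideal A -> ~ A `<=` M -> forall x, exists2 a, A a & M (x - a).
Proof.
move=> M_max M_fin A_id; apply: (@maximal_complement lie_subalgebra) => //.
- by move=> B [].
- by case: A_id.
- by apply: add_ideal_subalgebra => //; case: M_max => [[]].
Qed.

Lemma maximal_ideal_add A M :
  maximal_proper_closed lie_ideal M -> finite_codim M ->
  lie_ideal A -> ~ A `<=` M -> forall x, exists2 a, A a & M (x - a).
Proof.
move=> M_max M_fin A_id; apply: (@maximal_complement lie_ideal) => //.
- by move=> B [].
- by case: A_id.
- by apply: add_ideal_ideal => //; case: M_max => [[]].
Qed.

Lemma not_subset_proper (P : set L -> Prop) M : maximal_proper_closed P M ->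
  ~ (setT : set L) `<=` M.
Proof. by move=> [[_ _ MT] _] TM; apply: MT; apply/seteqP. Qed.

Lemma solvable_maximal_ideal M : lie_solvable L ->
  maximal_proper_closed lie_ideal M -> finite_codim M ->
  forall x y, M (lie x y).
Proof.
move=> [N LN0] M_max M_fin x y; have [[M_id _ _] _] := M_max.
have [M_lin M_lie] := M_id.
have [|n [LnM LSnM]] := @last_not_subset (lie_derived_series L) M
  (not_subset_proper M_max).
  by exists N; rewrite LN0 => _ ->; exact: linear_subspace0.
have LM := maximal_ideal_add M_max M_fin (derived_series_ideal n) LnM.
have [a Aa Ma] := LM x; have [b Ab Mb] := LM y.
rewrite -[x](subrK a) lieDl; apply: linear_subspaceD => //.
  exact: lie_idealC.
rewrite -[y](subrK b) lieDr; apply: linear_subspaceD => //; first exact: M_lie.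
by apply: LSnM; exact: lie_closure_lie.
Qed.

Lemma nilpotent_maximal_subalgebra M : lie_nilpotent L ->
  maximal_proper_closed lie_subalgebra M -> finite_codim M ->
  forall x y, M (lie x y).
Proof.
move=> [N LN0] M_max M_fin x y; have [[[M_lin M_lie] _ _] _] := M_max.
have [|n [LnM LSnM]] := @last_not_subset (lie_lower_series L) M
  (not_subset_proper M_max).
  by exists N; rewrite LN0 => _ ->; exact: linear_subspace0.
have LM := maximal_subalgebra_add M_max M_fin (lower_series_ideal n) LnM.
have AM u a : lie_lower_series L n a -> M (lie u a).
  by move=> Aa; apply: LSnM; exact: lie_closure_lie.
have [a Aa Ma] := LM x; have [b Ab Mb] := LM y.
rewrite -[y](subrK b) lieDr; apply: linear_subspaceD => //; last exact: AM.
rewrite -[x](subrK a) lieDl; apply: linear_subspaceD => //; first exact: M_lie.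
by rewrite lieC; apply: linear_subspaceN => //; exact: AM.
Qed.

(** A basis of [L] modulo [M] can be chosen inside [A] when [L = A + M]. It is a
spanning family of minimal size, moved into [A] modulo [M]. *)
Lemma finite_codim_basis A M : linear_subspace M -> finite_codim M ->
  (forall x, exists2 a, A a & M (x - a)) ->
  exists n (e : 'I_n -> L), [/\ forall i, A (e i),
    (forall x, exists c : 'I_n -> R[i], M (x - \sum_i c i *: e i)) &
    (forall c : 'I_n -> R[i], M (\sum_i c i *: e i) -> forall i, c i = 0)].
Proof.
move=> M_lin M_fin LAM.
pose spanning n := exists e : 'I_n -> L,
  forall x, exists c : 'I_n -> R[i], M (x - \sum_i c i *: e i).
have /ex_minnP[n /asboolP[e e_span] n_min] : exists n, `[<spanning n>].
  by have [n [e ?]] := M_fin; exists n; apply/asboolP; exists e.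
have /choice[a aP] : forall i, exists a, A a /\ M (e i - a).
  by move=> i; have [a ? ?] := LAM (e i); exists a.
have sumMB (c : 'I_n -> R[i]) : M (\sum_i c i *: e i - \sum_i c i *: a i).
  rewrite -sumrB; apply: linear_subspace_sum => // i.
  by rewrite -scalerBr; apply: linear_subspaceZ => //; have [] := aP i.
exists n, a; split=> [i|x|c Mc i]; first by have [] := aP i.
  have [c Mc] := e_span x; exists c.
  by rewrite -[x](subrK (\sum_i c i *: e i)) -addrA; apply: linear_subspaceD.
have {}Mc : M (\sum_i c i *: e i).
  by rewrite -[\sum_i _](subrK (\sum_i c i *: a i)); apply: linear_subspaceD.
apply/eqP; apply/negPn/negP => ci0.
(* A nontrivial relation modulo M allows e i to be discarded. *)
case: n e e_span n_min a aP sumMB c i Mc ci0 =>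
  [|n] e e_span n_min a aP sumMB c i Mc ci0.
  by case: i ci0.
suff /asboolP/n_min : spanning n by rewrite ltnn.
exists (fun j => e (lift i j)) => x; have [d Md] := e_span x.
exists (fun j => d (lift i j) - d i / c i * c (lift i j)).
have := linear_subspaceD M_lin Md (linear_subspaceZ (d i / c i) M_lin Mc).
congr M; rewrite !(bigD1_ord i) //= scalerDr scalerA divfK // scaler_sumr.
under [in RHS]eq_bigr do rewrite scalerBl -scalerA.
rewrite sumrB opprB -addrA; congr (x + _).
by rewrite addrC [X in X - _]addrC addrKA.
Qed.

End MaximalSubspaces.

(** * Maximal subalgebras of solvable Banach Lie algebras *)

Section SolvableSubalgebra.
Context {R : realType} {L : banachLieType R}.
Implicit Types (A B M N : set L) (a b x y : L).

(** Coordinates on [L / M]: a linear map [p] with kernel [M] onto row vectors, and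
a linear section [s] of [p] with values in [A]. *)
Lemma quotient_coordinates A M : linear_subspace A -> linear_subspace M ->
  finite_codim M -> (forall x, exists2 a, A a & M (x - a)) ->
  exists n (s : 'rV[R[i]]_n -> L) (p : L -> 'rV[R[i]]_n),
  [/\ (forall k u v, s (k *: u + v) = k *: s u + s v) /\
      (forall k x y, p (k *: x + y) = k *: p x + p y),
      forall v, A (s v), cancel s p, forall x, M (x - s (p x)) &
      forall x, M x <-> p x = 0].
Proof.
move=> A_lin M_lin M_fin LAM.
have [n [e [Ae e_span e_free]]] := finite_codim_basis M_lin M_fin LAM.
pose s (v : 'rV[R[i]]_n) := \sum_i v 0 i *: e i.
have s_lin k u v : s (k *: u + v) = k *: s u + s v.
  rewrite /s scaler_sumr -big_split /=; apply: eq_bigr => i _.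
  by rewrite !mxE scalerDl scalerA.
have s_inj v : M (s v) -> v = 0.
  by move=> /e_free v0; apply/rowP => i; rewrite v0 mxE.
have sB u v : s (u - v) = s u - s v.
  by rewrite addrC -scaleN1r s_lin scaleN1r addrC.
have /choice[p pP] : forall x, exists v, M (x - s v).
  move=> x; have [c Mc] := e_span x; exists (\row_i c i).
  by congr M: Mc; congr (_ - _); apply: eq_bigr => i _; rewrite mxE.
have p_eq x v : M (x - s v) -> p x = v.
  move=> Mv; apply/subr0_eq/s_inj; rewrite sB.
  have := linear_subspaceB M_lin Mv (pP x).
  by congr M; rewrite opprB addrC addrA subrK.
exists n, s, p; split=> //.
- split=> // k x y; apply: p_eq; rewrite s_lin opprD addrACA -scalerBr.
  by apply: linear_subspaceD => //; apply: linear_subspaceZ.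
- by move=> v; apply: linear_subspace_sum => // i; apply: linear_subspaceZ.
- by move=> v; apply: p_eq; rewrite subrr; exact: linear_subspace0.
have s0 : s 0 = 0 by rewrite -(subrr 0) sB subrr.
move=> x; split=> [Mx|px0]; first by apply: p_eq; rewrite s0 subr0.
by have := pP x; rewrite px0 s0 subr0.
Qed.

(** The descending step for the representation of [L] on [A / (A `&` M)]: the
conclusion says that [L_[k+1]] acts trivially, the last hypothesis that [L_[k+2]]
does. *)
Lemma derived_series_acts_trivially A M k :
  maximal_proper_closed lie_subalgebra M -> finite_codim M ->
  lie_ideal A -> ~ A `<=` M -> (forall a b, A a -> A b -> M (lie a b)) ->
  (forall a x, A a -> lie_derived_series L k.+2 x -> M (lie a x)) ->
  (forall a x, A a -> lie_derived_series L k.+1 x -> M (lie a x)).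
Proof.
move=> M_max M_fin A_id nAM AAM triv.
have LAM := maximal_subalgebra_add M_max M_fin A_id nAM.
have [[[M_lin M_lie] M_closed M_proper] M_maxl] := M_max.
have [A_lin A_lie] := A_id.
have [n [s [p [[s_lin p_lin] As sK sp p0]]]] :=
  quotient_coordinates A_lin M_lin M_fin LAM.
have n_gt0 : (n > 0)%N.
  case: n s p {s_lin p_lin As sK sp} p0 => // s p p0; case: nAM => a Aa.
  by apply/p0; exact: thinmx0.
have pD x y : p (x + y) = p x + p y by rewrite -[x]scale1r p_lin !scale1r.
have pN x : p (- x) = - p x.
  have p00 : p 0 = 0 by apply/p0; exact: linear_subspace0.
  by rewrite -[- x]addr0 -scaleN1r p_lin p00 addr0 scaleN1r.
have pB x y : p (x - y) = p x - p y by rewrite pD pN.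
have p_sp x : p (s (p x)) = p x by rewrite sK.
(* As L = A + M, the set A `&` M is an ideal of L. *)
have AM_lie x b : A b -> M b -> M (lie b x).
  move=> Ab Mb; have [a Aa Ma] := LAM x; rewrite -[x](subrK a) lieDr.
  by apply: linear_subspaceD => //; [exact: M_lie|exact: AAM].
(* rho x is the operator induced by lie^~ x on A / (A `&` M), read in the
   coordinates p; with row vectors, rho is a morphism of Lie algebras. *)
have /choice[rho rhoE] : forall x, exists C : 'M[R[i]]_n,
    forall v, v *m C = p (lie (s v) x).
  by move=> x; apply: linear_mx => c u v; rewrite s_lin lie_linearl p_lin.
have rhoA x a : A a -> p a *m rho x = p (lie a x).
  move=> Aa; rewrite rhoE; apply/eqP; rewrite -subr_eq0 -pB -lieBl; apply/eqP/p0.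
  rewrite -opprB lieNl; apply: linear_subspaceN => //; apply: AM_lie => //.
  exact: linear_subspaceB.
have rho_lie x y : rho (lie x y) = rho x *m rho y - rho y *m rho x.
  apply/row_matrixP => i; rewrite !rowE.
  set v := delta_mx 0 i; rewrite mulmxBr !mulmxA ![v *m _]rhoE.
  rewrite !rhoA; [|exact: lie_idealC..].
  by rewrite -pB lie_derivation [lie x _]lieC.
(* Irreducibility: the preimage N of an invariant subspace is a closed subalgebra
   containing M, hence equal to M or to L. *)
have rho_irr (W : 'rV[R[i]]_n -> Prop) :
    (forall c u v, W u -> W v -> W (c *: u + v)) ->
    (forall C v, (exists x, C = rho x) -> W v -> W (v *m C)) ->
    (exists2 v, v != 0 & W v) -> forall v, W v.
  move=> W_lin W_rho [v0 v0N0 Wv0].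
  have W0 : W 0 by rewrite -(subrr v0) -scaleN1r addrC; apply: W_lin.
  pose N := [set x | W (p x)].
  have MN : M `<=` N by move=> x /p0; rewrite /N /= => ->.
  have N_lin : linear_subspace N.
    apply/linear_subspaceP; split=> [|c u v Nu Nv].
      by apply: MN; exact: linear_subspace0.
    by rewrite /N /= p_lin; apply: W_lin.
  have NA_lie a x : A a -> N a -> N (lie a x).
    by move=> Aa Na; rewrite /N /= -rhoA //; apply: W_rho => //; exists x.
  have N_s x : N x -> N (s (p x)) by rewrite /N /= p_sp.
  suff NT : N = setT.
    by move=> v; rewrite -[v]sK; suff : N (s v) by []; rewrite NT.
  apply: contrapT => nNT; have : N = M.
    apply: M_maxl => //; split=> //; last first.
      exact: closed_finite_codim_sub M_closed M_lin M_fin N_lin MN.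
    split=> // x y Nx Ny.
    rewrite -[x](subrK (s (p x))) lieDl; apply: (linear_subspaceD N_lin);
      last by apply: NA_lie => //; exact: N_s.
    rewrite -[y](subrK (s (p y))) lieDr; apply: linear_subspaceD => //.
      by apply: MN; exact: M_lie.
    rewrite lieC; apply: linear_subspaceN => //.
    by apply: NA_lie => //; exact: N_s.
  move=> NM; have : N (s v0) by rewrite /N /= sK.
  by rewrite NM => /p0; rewrite sK => /eqP; apply/negP.
have D_id := @derived_series_ideal R L k.+1.
have rho_scalar x : lie_derived_series L k.+1 x -> exists c : R[i], rho x = c%:M.
  move=> Dx; apply: (@irreducible_commuting_scalar _ _
    (fun C => exists x, C = rho x)
    (fun C => exists2 x, lie_derived_series L k.+1 x & C = rho x)) => //.
  - move=> _ _ [y Dy ->] [z Dz ->]; apply/subr0_eq; rewrite -rho_lie.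
    apply/row_matrixP => i; rewrite !rowE mulmx0 rhoE.
    by apply/p0/triv => //; exact: lie_closure_lie.
  - move=> _ _ [y Dy ->] [z ->]; exists (lie z y) => //.
    by case: D_id => _; apply.
  - by exists x.
move=> a x Aa; move: x.
have T_lin : linear_subspace [set x | M (lie x a)].
  exact: preimage_lie_subspace.
suff D_sub : lie_derived_series L k.+1 `<=` [set x | M (lie x a)].
  by move=> x /D_sub /= ?; rewrite lieC; exact: linear_subspaceN.
apply: lie_closure_sub => //; first exact: preimage_lie_closed.
move=> x y Dx Dy /=; rewrite lieC; apply: linear_subspaceN => //.
(* rho (lie x y) is scalar, and it is a commutator, so its trace vanishes. *)
have [c rho_c] := rho_scalar (lie x y) (lie_closure_lie Dx Dy).
have c0 : c = 0.
  have : \tr (rho (lie x y)) = 0 by rewrite rho_lie raddfB /= mxtrace_mulC subrr.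
  rewrite rho_c mxtrace_scalar => /eqP.
  by rewrite mulrn_eq0 -[n == _]negbK -lt0n n_gt0 => /eqP.
by apply/p0; rewrite -rhoA // rho_c c0 mul_mx_scalar scale0r.
Qed.

Lemma solvable_maximal_subalgebra M : lie_solvable L ->
  maximal_proper_closed lie_subalgebra M -> finite_codim M ->
  lie_derived_series L 2 `<=` M.
Proof.
move=> [N LN0] M_max M_fin; have [[[M_lin M_lie] M_closed _] _] := M_max.
have [|n [LnM LSnM]] := @last_not_subset _ _ (lie_derived_series L) M
  (not_subset_proper M_max).
  by exists N; rewrite LN0 => _ ->; exact: linear_subspace0.
set A := lie_derived_series L n in LnM.
have A_id : lie_ideal A := derived_series_ideal n.
have AAM a b : A a -> A b -> M (lie a b).
  by move=> Aa Ab; apply: LSnM; exact: lie_closure_lie.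
have LAM := maximal_subalgebra_add M_max M_fin A_id LnM.
(* A, which is the n-th term, acts trivially, hence so does the first term: when
   n = 0 by inclusion, and when n > 0 by descending from n to 1. *)
have triv a x : A a -> lie_derived_series L 1 x -> M (lie a x).
  suff: forall m,
      (forall a x, A a -> lie_derived_series L m.+1 x -> M (lie a x)) ->
      forall a x, A a -> lie_derived_series L 1 x -> M (lie a x).
    move=> H; case: n @A {LnM LSnM A_id LAM} AAM H => [|n] A AAM H Aa.
      by move=> _; exact: AAM.
    by apply: H Aa; exact: AAM.
  elim=> // m IHm H; apply: IHm; exact: derived_series_acts_trivially H.
apply: lie_closure_sub => // x y Dx Dy.
have [a Aa Ma] := LAM x; have [b Ab Mb] := LAM y.
rewrite -[x in lie x y](subrK a) lieDl.
apply: linear_subspaceD => //; last exact: triv.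
rewrite -[y](subrK b) lieDr; apply: linear_subspaceD => //; first exact: M_lie.
rewrite lieC; apply: linear_subspaceN => //; rewrite lieBr.
by apply: linear_subspaceB => //; [exact: triv|exact: AAM].
Qed.

End SolvableSubalgebra.

Theorem theorem9p10 (R : realType) :
  (forall L : banachLieType R,
     Sem P_Smax L -> lie_solvable L -> lie_derived_series L 2 = [set 0]) /\
  (forall L : banachLieType R,
     Sem P_Smax L -> (lie_nilpotent L <-> lie_commutative L)) /\
  (forall L : banachLieType R,
     Sem P_Jmax L -> lie_solvable L -> lie_commutative L).
Proof.
split=> [L PL L_solv|].
  apply/seteqP; split=> [x L2x|_ ->]; last first.
    exact: linear_subspace0 (@lie_closure_linear_subspace _ _ _ _).
  by rewrite -PL => M [M_max M_fin]; exact: solvable_maximal_subalgebra L2x.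
split=> L PL; last first.
  move=> L_solv x y; suff : P_Jmax L (lie x y) by rewrite PL.
  by move=> M [M_max M_fin]; exact: solvable_maximal_ideal.
split=> [L_nil x y|L_com].
  suff : P_Smax L (lie x y) by rewrite PL.
  by move=> M [M_max M_fin]; exact: nilpotent_maximal_subalgebra.
exists 1%N; apply/seteqP; split=> [|_ ->]; last first.
  exact: linear_subspace0 (@lie_closure_linear_subspace _ _ _ _).
apply: lie_closure_sub => [||a b _ _]; last exact: L_com.
  apply/linear_subspaceP; split=> // k u v -> ->.
  by rewrite scaler0 addr0.
exact/accessible_closed_set1/hausdorff_accessible/norm_hausdorff.
Qed.
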